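(* Let $n \geq 3$, let $c \in \mathbb{R}$, and let $\widetilde M^n(4c)$ be a complex space form of complex dimension $n$ and constant holomorphic sectional curvature $4c$. Let $M^n$ be a Lagrangian submanifold of $\widetilde M^n(4c)$ with induced metric $g$ and second fundamental form $h$. If $M^n$ is pseudo-parallel, i.e. if there exists a function $\phi$ on $M^n$ such that $$\overline{R}\cdot h + \phi\, Q(g,h) = 0,$$ then $M^n$ is semi-parallel, i.e. $\overline{R}\cdot h = 0$.
   Context: A complex space form $\widetilde M^n(4c)$ is a Kähler manifold of complex dimension $n$ (real dimension $2n$), with complex structure $J$, of constant holomorphic sectional curvature $4c$. A submanifold $M^n$ of real dimension $n$ is Lagrangian if $J$ maps each tangent space $T_pM$ onto the normal space $T_p^\perp M$. Let $g$ be the induced metric on $M$ (also used for the ambient metric), $h$ the second fundamental form, $R$ the Riemann curvature tensor of $M$, with the convention $R(X,Y)Z=\nabla_X\nabla_YZ-\nabla_Y\nabla_XZ-\nabla_{[X,Y]}Z$, and $R^\perp$ the curvature tensor of the normal connection (same sign convention). For tangent vectors define $$(X\wedge Y)Z = g(Y,Z)X - g(X,Z)Y.$$ $\overline{R}$ denotes the curvature operator of the Van der Waerden–Bortolotti connection (the connection induced by $\nabla$ and $\nabla^\perp$); it acts on $h$ as a derivation: $$(\overline{R}\cdot h)(X,Y,Z,W) = R^{\perp}(X,Y)h(Z,W) - h(R(X,Y)Z,W) - h(Z,R(X,Y)W).$$ The tensor $Q(g,h)$ is defined by $$Q(g,h)(X,Y,U,V) = h((X\wedge Y)U,V) + h(U,(X\wedge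 Y)V).$$ Here $X,Y,Z,W,U,V$ are arbitrary tangent vectors to $M$ at a common point. The function $\phi$ is a real-valued function on $M$. $M$ is called pseudo-parallel if $\overline{R}\cdot h + \phi\, Q(g,h)=0$ for some function $\phi$ on $M$, and semi-parallel if $\overline{R}\cdot h=0$ on $M$. *)

(* Defs.v *)
From HB Require Import structures.
From mathcomp Require Import all_boot all_order all_algebra.
From mathcomp Require Import all_classical all_reals all_analysis.
Set Implicit Arguments.
Unset Strict Implicit.
Unset Printing Implicit Defensive.
Import Order.TTheory GRing.Theory Num.Theory numFieldNormedType.Exports.
Local Open Scope classical_set_scope.
Local Open Scope ring_scope.

(* Points of R^n and coordinate tangent vectors are
   row vectors, so an endomorphism J acts as v |-> v *m J. *)

Fixpoint Ck (R : realType) (V W : normedModType R) (k : nat) (A : set V)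
    (f : V -> W) : Prop :=
  if k is k'.+1 then
    (forall x, A x -> differentiable f x) /\
    (forall v : V, Ck k' A (fun x => 'D_v f x))
  else forall x, A x -> {for x, continuous f}.

Definition smooth_on (R : realType) (V W : normedModType R) (A : set V)
    (f : V -> W) : Prop := forall k, Ck k A f.

(* A manifold with an atlas indexed by [chart].  [param i] is the inverse of
   [coord i] on [coord i @` dom i]; outside [dom i], resp. outside that image,
   the values of [coord i], resp. [param i], are irrelevant. *)
Record smooth_manifold (R : realType) (n : nat) := SmoothManifold {
  carrier :> topologicalType;
  chart : Type;
  dom : chart -> set carrier;
  coord : chart -> carrier -> 'rV[R]_n;
  param : chart -> 'rV[R]_n -> carrier;
  manifold_hausdorff : hausdorff_space carrier;
  manifold_second_countable : @second_countable carrier;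
  dom_open : forall i, open (dom i);
  dom_cover : forall p, exists i, dom i p;
  image_open : forall i, open (coord i @` dom i);
  coordK : forall i p, dom i p -> param i (coord i p) = p;
  coord_continuous : forall i p, dom i p -> {for p, continuous (coord i)};
  param_continuous : forall i x, (coord i @` dom i) x ->
    {for x, continuous (param i)};
  transition_smooth : forall i j,
    smooth_on (coord i @` (dom i `&` dom j)) (coord j \o param i)
}.

Definition inner (R : realType) (n : nat) (A : 'M[R]_n) (u v : 'rV[R]_n) : R :=
  (u *m A *m v^T) 0 0.

Definition partial (R : realType) (n : nat) (i : 'I_n) (f : 'rV[R]_n -> R) :
    'rV[R]_n -> R := fun x => 'D_(delta_mx 0 i) f x.

Definition christoffel (R : realType) (n : nat) (G : 'rV[R]_n -> 'M[R]_n)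
    (x : 'rV[R]_n) (i j k : 'I_n) : R :=
  2^-1 * \sum_(l < n) invmx (G x) k l *
    (partial i (fun y => G y j l) x + partial j (fun y => G y i l) x
     - partial l (fun y => G y i j) x).

Definition christoffel_form (R : realType) (n : nat) (G : 'rV[R]_n -> 'M[R]_n)
    (x u v : 'rV[R]_n) : 'rV[R]_n :=
  \row_k \sum_(i < n) \sum_(j < n) u 0 i * v 0 j * christoffel G x i j k.

(* Covariant derivative of a vector field V along F : R^n -> R^m, for the
   pull-back by F of the Levi-Civita connection of the metric G on R^m. *)
Definition cov_along (R : realType) (n m : nat) (F : 'rV[R]_n -> 'rV[R]_m)
    (G : 'rV[R]_m -> 'M[R]_m) (X : 'rV[R]_n -> 'rV[R]_n)
    (V : 'rV[R]_n -> 'rV[R]_m) : 'rV[R]_n -> 'rV[R]_m :=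
  fun x => 'D_(X x) V x + christoffel_form G (F x) ('D_(X x) F x) (V x).

Definition levi_civita (R : realType) (n : nat) (G : 'rV[R]_n -> 'M[R]_n)
    (X Y : 'rV[R]_n -> 'rV[R]_n) : 'rV[R]_n -> 'rV[R]_n :=
  fun x => 'D_(X x) Y x + christoffel_form G x (X x) (Y x).

Definition lie_bracket (R : realType) (n : nat) (X Y : 'rV[R]_n -> 'rV[R]_n) :
    'rV[R]_n -> 'rV[R]_n :=
  fun x => 'D_(X x) Y x - 'D_(Y x) X x.

Definition curvature (R : realType) (n m : nat)
    (D : ('rV[R]_n -> 'rV[R]_n) -> ('rV[R]_n -> 'rV[R]_m) ->
         ('rV[R]_n -> 'rV[R]_m))
    (X Y : 'rV[R]_n -> 'rV[R]_n) (S : 'rV[R]_n -> 'rV[R]_m) :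
    'rV[R]_n -> 'rV[R]_m :=
  fun x => D X (D Y S) x - D Y (D X S) x - D (lie_bracket X Y) S x.

(* Curvature being tensorial, its value on tangent vectors at x is computed on
   their extensions with constant coordinates; same remark for the second
   fundamental form and the normal curvature below. *)
Definition riemann (R : realType) (n : nat) (G : 'rV[R]_n -> 'M[R]_n)
    (x u v w : 'rV[R]_n) : 'rV[R]_n :=
  curvature (levi_civita G) (cst u) (cst v) (cst w) x.

Definition sectional (R : realType) (n : nat) (G : 'rV[R]_n -> 'M[R]_n)
    (x u v : 'rV[R]_n) : R :=
  inner (G x) (riemann G x u v v) u /
  (inner (G x) u u * inner (G x) v v - inner (G x) u v ^+ 2).

Definition wedge (R : realType) (n : nat) (A : 'M[R]_n) (u v w : 'rV[R]_n) :
    'rV[R]_n := inner A v w *: u - inner A u w *: v.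

Definition induced_metric (R : realType) (n m : nat)
    (F : 'rV[R]_n -> 'rV[R]_m) (G : 'rV[R]_m -> 'M[R]_m) :
    'rV[R]_n -> 'M[R]_n :=
  fun x => \matrix_(i, j)
    inner (G (F x)) ('D_(delta_mx 0 i) F x) ('D_(delta_mx 0 j) F x).

Definition tangent_part (R : realType) (n m : nat) (F : 'rV[R]_n -> 'rV[R]_m)
    (G : 'rV[R]_m -> 'M[R]_m) (x : 'rV[R]_n) (w : 'rV[R]_m) : 'rV[R]_m :=
  \sum_(i < n) \sum_(j < n)
    (invmx (induced_metric F G x) i j *
     inner (G (F x)) w ('D_(delta_mx 0 i) F x)) *: 'D_(delta_mx 0 j) F x.

Definition normal_part (R : realType) (n m : nat) (F : 'rV[R]_n -> 'rV[R]_m)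
    (G : 'rV[R]_m -> 'M[R]_m) (x : 'rV[R]_n) (w : 'rV[R]_m) : 'rV[R]_m :=
  w - tangent_part F G x w.

Definition normal_connection (R : realType) (n m : nat)
    (F : 'rV[R]_n -> 'rV[R]_m) (G : 'rV[R]_m -> 'M[R]_m)
    (X : 'rV[R]_n -> 'rV[R]_n) (xi : 'rV[R]_n -> 'rV[R]_m) :
    'rV[R]_n -> 'rV[R]_m :=
  fun x => normal_part F G x (cov_along F G X xi x).

Definition second_form (R : realType) (n m : nat) (F : 'rV[R]_n -> 'rV[R]_m)
    (G : 'rV[R]_m -> 'M[R]_m) (x u v : 'rV[R]_n) : 'rV[R]_m :=
  normal_part F G x (cov_along F G (cst u) (fun y => 'D_v F y) x).

(* The normal curvature acts on the normal vector h(z, w) through its extension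
   to the normal field obtained from the constant coordinate fields z and w. *)
Definition Rbar_h (R : realType) (n m : nat) (F : 'rV[R]_n -> 'rV[R]_m)
    (G : 'rV[R]_m -> 'M[R]_m) (x X Y Z W : 'rV[R]_n) : 'rV[R]_m :=
  let h := second_form F G in
  let Rm := riemann (induced_metric F G) in
  curvature (normal_connection F G) (cst X) (cst Y) (fun y => h y Z W) x
  - h x (Rm x X Y Z) W - h x Z (Rm x X Y W).

Definition Q_gh (R : realType) (n m : nat) (F : 'rV[R]_n -> 'rV[R]_m)
    (G : 'rV[R]_m -> 'M[R]_m) (x X Y U V : 'rV[R]_n) : 'rV[R]_m :=
  let h := second_form F G in
  let g := induced_metric F G x in
  h x (wedge g X Y U) V + h x U (wedge g X Y V).

(* Tensor fields are given by their components in each chart, subject to the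
   transformation laws.  The Kaehler condition is: J is a g-orthogonal almost
   complex structure, parallel for the Levi-Civita connection. *)
Record kaehler_manifold (R : realType) (n : nat) := KaehlerManifold {
  kbase :> smooth_manifold R n.*2;
  metric : chart kbase -> 'rV[R]_(n.*2) -> 'M[R]_(n.*2);
  cplx : chart kbase -> 'rV[R]_(n.*2) -> 'M[R]_(n.*2);
  metric_smooth : forall a, smooth_on (coord a @` dom a) (metric a);
  metric_sym : forall a x, (coord a @` dom a) x -> (metric a x)^T = metric a x;
  metric_posdef : forall a x, (coord a @` dom a) x ->
    forall u, u != 0 -> 0 < inner (metric a x) u u;
  metric_transition : forall a b x, (coord a @` (dom a `&` dom b)) x ->
    let t := coord b \o param a in
    forall u v, inner (metric a x) u v =
      inner (metric b (t x)) ('D_u t x) ('D_v t x);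
  cplx_smooth : forall a, smooth_on (coord a @` dom a) (cplx a);
  cplx_transition : forall a b x, (coord a @` (dom a `&` dom b)) x ->
    let t := coord b \o param a in
    forall u, 'D_(u *m cplx a x) t x = 'D_u t x *m cplx b (t x);
  cplx_sqr : forall a x, (coord a @` dom a) x ->
    cplx a x *m cplx a x = - 1%:M;
  cplx_orthogonal : forall a x, (coord a @` dom a) x ->
    forall u v, inner (metric a x) (u *m cplx a x) (v *m cplx a x) =
      inner (metric a x) u v;
  cplx_parallel : forall a x, (coord a @` dom a) x ->
    forall u v,
      levi_civita (metric a) (cst u) (fun y => v *m cplx a y) x =
      levi_civita (metric a) (cst u) (cst v) x *m cplx a x
}.

Definition constant_holomorphic_curvature (R : realType) (n : nat)
    (N : kaehler_manifold R n) (k : R) : Prop :=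
  forall (a : chart N) x, (coord a @` dom a) x ->
    forall u, u != 0 -> sectional (metric a) x u (u *m cplx a x) = k.

Definition local_rep (R : realType) (n m : nat) (M : smooth_manifold R n)
    (N : smooth_manifold R m) (f : M -> N) (i : chart M) (a : chart N) :
    'rV[R]_n -> 'rV[R]_m := coord a \o f \o param i.

Definition immersion (R : realType) (n m : nat) (M : smooth_manifold R n)
    (N : smooth_manifold R m) (f : M -> N) : Prop :=
  [/\ continuous f,
      forall i a, smooth_on (coord i @` (dom i `&` f @^-1` dom a))
                            (local_rep f i a)
    & forall p i a, dom i p -> dom a (f p) ->
        forall v, 'D_v (local_rep f i a) (coord i p) = 0 -> v = 0].

Definition lagrangian (R : realType) (n : nat) (M : smooth_manifold R n)
    (N : kaehler_manifold R n) (f : M -> N) : Prop :=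
  forall p (i : chart M) (a : chart N), dom i p -> dom a (f p) ->
    let F := local_rep f i a in
    let x := coord i p in
    forall w, (forall v, inner (metric a (F x)) w ('D_v F x) = 0) <->
      (exists v, w = 'D_v F x *m cplx a (F x)).

Definition pseudo_parallel (R : realType) (n : nat) (M : smooth_manifold R n)
    (N : kaehler_manifold R n) (f : M -> N) : Prop :=
  exists phi : M -> R,
    forall p (i : chart M) (a : chart N), dom i p -> dom a (f p) ->
      let F := local_rep f i a in
      let x := coord i p in
      forall X Y Z W, Rbar_h F (metric a) x X Y Z W
        + phi p *: Q_gh F (metric a) x X Y Z W = 0.

Definition semi_parallel (R : realType) (n : nat) (M : smooth_manifold R n)
    (N : kaehler_manifold R n) (f : M -> N) : Prop :=
  forall p (i : chart M) (a : chart N), dom i p -> dom a (f p) ->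
    forall X Y Z W,
      Rbar_h (local_rep f i a) (metric a) (coord i p) X Y Z W = 0.

(* Main.v *)
Require Import Defs.
From mathcomp Require Import all_boot all_order all_algebra.
From mathcomp Require Import all_classical all_reals all_analysis.
From mathcomp Require Import ring lra.
Set Implicit Arguments.
Unset Strict Implicit.
Unset Printing Implicit Defensive.
Import Order.TTheory GRing.Theory Num.Theory numFieldNormedType.Exports.
Local Open Scope classical_set_scope.
Local Open Scope ring_scope.

(* Since J is parallel and exchanges tangent and normal spaces, the cubic form
   C(Z,W,V) = g(h(Z,W), JV) is symmetric in W and V, and R^perp(X,Y) JV = J R(X,Y)V.
   Hence g((Rbar.h)(X,Y,Z,W), JV) is minus the derivation R(X,Y) applied to C, so
   it is symmetric in W and V too.  Where phi is nonzero, the same symmetry must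
   hold for Q(g,h), which says C(Z, BW, V) = C(Z, W, BV) for all B = X /\ Y.  As B
   is skew, C(Z, ., .) then anticommutes with every X /\ Y, which forces C = 0 when
   n >= 3; so h = 0 and Q(g,h) = 0 there. *)

(** * Calculus of C^k maps *)

(** What breaks the symmetry is the normal index: R^perp moves it, whereas Q(g,h) acts on the two
    tangent indices only. After pairing with JV, the swap of W and V fixes the term C(BZ,W,V) of
    Q(g,h), which cancels and leaves a condition in which Z is frozen. The bound n >= 3 enters at
    the last linear step: in dimension 2 every trace-free symmetric operator anticommutes with the
    quarter turn, so nothing more than a zero trace would follow. The dichotomy on phi is made point
    by point.

    The obstacle is that curvatures are iterated derivatives of fields with prescribed extensions.
    Writing h(Z,W) = J dF(s) makes s a variable field, and applying R^perp J = J R to it would first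
    need tensoriality. The curvature is moved to the other factor instead: g(h(Z,W), J dF(V)) is
    differentiated twice with V constant. This costs commutation of second derivatives and
    smoothness of every field involved, including inverse metrics and Christoffel symbols, hence the
    calculus of C^k maps. *)

Lemma near_eq_differentiable (R : realType) (V W : normedModType R)
    (f g : V -> W) (x : V) :
  (\near x, f x = g x) -> differentiable f x -> differentiable g x.
Proof.
move=> fg df; apply/diff_locallyP.
have fgx : f x = g x by apply: nbhs_singleton fg.
have [dc /eqaddoP fo] := (diff_locallyP _ _).1 df.
have go : g \o shift x = cst (g x) + 'd f x +o_ 0 id.
  apply/eqaddoP => e e0; rewrite -fgx.
  have fg0 : \forall h \near 0, f (h + x) = g (h + x).
    have cx : h + x @[h --> (0 : V)] --> x.
      by rewrite -[X in _ --> X]add0r; apply: cvgD; [exact: cvg_id|exact: cvg_cst].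
    exact: cx _ fg.
  by apply: filterS2 fg0 (fo e e0) => h /= eqh; rewrite !fctE /= eqh.
have -> : 'd g x = 'd f x :> (V -> W) by apply: (diff_unique dc go).
by split.
Qed.

Section Ck_lemmas.
Context {R : realType} {V : normedModType R}.
Implicit Types (A : set V) (f g : V -> R).

(** Openness of [A] makes agreement on [A] an agreement of germs, so it passes to all derivatives.
    Formulas for derivatives hold only on [A]; this lemma is what allows rewriting with them. *)
Lemma Ck_ext {W : normedModType R} k A (f g : V -> W) : open A ->
  (forall x, A x -> f x = g x) -> Ck k A f -> Ck k A g.
Proof.
move=> oA; elim: k f g => [|k IH] f g fg /=.
  move=> cf x Ax; rewrite /prop_for /continuous_at -(fg x Ax).
  apply: cvg_trans (cf x Ax); apply: near_eq_cvg.
  by move: (open_nbhs_nbhs (conj oA Ax)); apply: filterS => y /fg.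
move=> [df Df].
have nfg x : A x -> \near x, f x = g x.
  by move=> Ax; move: (open_nbhs_nbhs (conj oA Ax)); apply: filterS => y /fg.
split=> [x Ax|v]; first exact: near_eq_differentiable (nfg x Ax) (df x Ax).
by apply: IH (Df v) => x Ax; exact: near_eq_derive (nfg x Ax).
Qed.

Lemma CkW {W : normedModType R} k A (f : V -> W) : Ck k.+1 A f -> Ck k A f.
Proof.
elim: k f => [|k IH] f [df Df].
  by move=> x /df /differentiable_continuous.
by split=> // v; apply: IH; exact: Df.
Qed.

Lemma Ck_cst {W : normedModType R} k A (c : W) : Ck k A (fun=> c).
Proof.
elim: k c => [|k IH] c /=; first by move=> x _; exact: cvg_cst.
split=> [x _|v]; first exact: differentiable_cst.
have -> : (fun x : V => 'D_v (fun=> c) x) = (fun=> 0).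
  by apply/funext => x; rewrite derive_cst.
exact: IH.
Qed.

Lemma CkD {W : normedModType R} k A (f g : V -> W) : open A ->
  Ck k A f -> Ck k A g -> Ck k A (fun x => f x + g x).
Proof.
move=> oA; elim: k f g => [|k IH] f g.
  by move=> cf cg x Ax; apply: cvgD; [exact: cf|exact: cg].
move=> [df Df] [dg Dg]; split=> [x Ax|v].
  by apply: differentiableD; [exact: df|exact: dg].
apply: Ck_ext (IH _ _ (Df v) (Dg v)) => // x Ax.
by rewrite [RHS]deriveD //; apply: diff_derivable; [exact: df|exact: dg].
Qed.

Lemma CkM k A f g : open A -> Ck k A f -> Ck k A g ->
  Ck k A (fun x => f x * g x).
Proof.
move=> oA; elim: k f g => [|k IH] f g.
  by move=> cf cg x Ax; apply: cvgM; [exact: cf|exact: cg].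
move=> cf cg; have [df Df] := cf; have [dg Dg] := cg; split=> [x Ax|v].
  by apply: differentiableM; [exact: df|exact: dg].
have fDg := IH _ _ (CkW cf) (Dg v).
have gDf := IH _ _ (CkW cg) (Df v).
apply: Ck_ext (CkD oA fDg gDf) => // x Ax.
by rewrite [RHS]deriveM //; apply: diff_derivable; [exact: df|exact: dg].
Qed.

Lemma Ck_sum {W : normedModType R} k A (I : Type) (r : seq I) (P : pred I)
    (F : I -> V -> W) : open A -> (forall i, Ck k A (F i)) ->
  Ck k A (fun x => \sum_(i <- r | P i) F i x).
Proof.
move=> oA cF; elim: r => [|i r IH].
  by apply: Ck_ext (Ck_cst k A (0 : W)) => // x _; rewrite big_nil.
case Pi: (P i); last first.
  by apply: Ck_ext IH => // x _; rewrite big_cons Pi.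
by apply: Ck_ext (CkD oA (cF i) IH) => // x _; rewrite big_cons Pi.
Qed.

Lemma Ck_prod k A (I : Type) (r : seq I) (P : pred I)
    (F : I -> V -> R) : open A -> (forall i, Ck k A (F i)) ->
  Ck k A (fun x => \prod_(i <- r | P i) F i x).
Proof.
move=> oA cF; elim: r => [|i r IH].
  by apply: Ck_ext (Ck_cst k A (1 : R)) => // x _; rewrite big_nil.
case Pi: (P i); last first.
  by apply: Ck_ext IH => // x _; rewrite big_cons Pi.
by apply: Ck_ext (CkM oA (cF i) IH) => // x _; rewrite big_cons Pi.
Qed.

Lemma CkV k A f : open A -> (forall x, A x -> f x != 0) -> Ck k A f ->
  Ck k A (fun x => (f x)^-1).
Proof.
move=> oA f0; elim: k => [|k IH] cf.
  by move=> x Ax; apply: cvgV; [exact: f0|exact: cf].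
have [df Df] := cf; split=> [x Ax|v].
  by apply: differentiableV; [exact: df|exact: f0].
have fV := IH (CkW cf).
have DV := CkM oA (CkM oA (Ck_cst k A (-1 : R)) (CkM oA fV fV)) (Df v).
apply: Ck_ext DV => // x Ax; rewrite [RHS]deriveV ?f0 //.
  by rewrite /= -[_ *: _]/(_ * _) expr2 mulN1r invfM.
by apply: diff_derivable; exact: df.
Qed.

End Ck_lemmas.

(** * Matrix-valued maps and their entries *)

Section Ck_matrix.
Context {R : realType} {V : normedModType R}.
Implicit Types (A : set V).

Lemma differentiable_mxP p q (f : V -> 'M[R]_(p, q)) x :
  differentiable f x <-> forall i j, differentiable (fun y => f y i j) x.
Proof.
split=> [df i j|df].
  exact: differentiable_comp df (differentiable_coord _ _ _).
have -> : f = \sum_(i < p) \sum_(j < q) fun x => f x i j *: delta_mx i j.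
  apply/funext => y; rewrite {1}(matrix_sum_delta (f y)) fct_sumE.
  by apply: eq_bigr => i _; rewrite fct_sumE.
by do 2!apply: differentiable_sum => ?; exact: differentiableZl.
Qed.

Lemma derive_coord p q (f : V -> 'M[R]_(p, q)) x v i j : differentiable f x ->
  ('D_v f x) i j = 'D_v (fun y => f y i j) x.
Proof. by move=> df; rewrite derive_mx ?mxE //; exact: diff_derivable. Qed.

Lemma Ck_mxP p q k A (f : V -> 'M[R]_(p, q)) : open A ->
  Ck k A f <-> forall i j, Ck k A (fun y => f y i j).
Proof.
move=> oA; elim: k f => [|k IH] f.
  split=> [cf i j x Ax|cf].
    apply: (@continuous_comp _ _ _ f (fun M : 'M[R]_(p, q) => M i j)).
      exact: cf.
    exact: coord_continuous.
  have cZ i j : Ck 0 A (fun x => f x i j *: (delta_mx i j : 'M[R]_(p, q))).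
    by move=> x Ax; apply: cvgZr_tmp; exact: cf.
  apply: Ck_ext (Ck_sum _ _ oA (fun i => Ck_sum _ _ oA (cZ i))) => // x _.
  by rewrite {2}(matrix_sum_delta (f x)).
split=> [[df Df] i j|cf].
  split=> [x Ax|v]; first exact: ((differentiable_mxP f x).1 (df x Ax)).
  have /IH/(_ i j) := Df v; apply: Ck_ext => // x Ax.
  by rewrite derive_coord //; exact: df.
have df x : A x -> differentiable f x.
  by move=> Ax; apply/differentiable_mxP => i j; have [/(_ x Ax)] := cf i j.
split=> // v; apply/IH => i j; have [_ /(_ v)] := cf i j.
by apply: Ck_ext => // x Ax; rewrite derive_coord //; exact: df.
Qed.

End Ck_matrix.

(** * Schwarz's theorem and smooth maps *)

Section schwarz.
Context {R : realType} {V : normedModType R}.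
Implicit Types (f : V -> R) (u v x y : V).

Lemma is_derive_line f u y t d : is_derive (t *: u + y) u f d ->
  is_derive t 1 (fun s : R => f (s *: u + y)) d.
Proof.
have E : (fun h : R => h^-1 *: (f ((h *: (1 : R) + t) *: u + y) - f (t *: u + y)))
       = (fun h : R => h^-1 *: (f (h *: u + (t *: u + y)) - f (t *: u + y))).
  by apply/funext => h; rewrite -[h *: 1]/(h * 1) mulr1 scalerDl addrA.
by case=> df <-; apply: DeriveDef; rewrite /derivable /derive /= E.
Qed.

Lemma is_derive_shift_arg f u w z d : is_derive (z + w) u f d ->
  is_derive z u (fun y => f (y + w)) d.
Proof.
have E : (fun h : R => h^-1 *: (f (h *: u + z + w) - f (z + w)))
       = (fun h : R => h^-1 *: (f (h *: u + (z + w)) - f (z + w))).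
  by apply/funext => h; rewrite addrA.
by case=> df <-; apply: DeriveDef; rewrite /derivable /derive /= E.
Qed.

Lemma MVT_line f u y (h : R) (df : V -> R) : 0 < h ->
  (forall t : R, 0 <= t <= h -> is_derive (t *: u + y) u f (df (t *: u + y))) ->
  exists2 t : R, 0 <= t <= h & f (h *: u + y) - f y = df (t *: u + y) * h.
Proof.
move=> h0 fD.
have gD t : t \in `[0, h] ->
    is_derive t 1 (fun s : R => f (s *: u + y)) (df (t *: u + y)).
  by rewrite in_itv /= => /fD; exact: is_derive_line.
pose g (s : R) : R := f (s *: u + y).
pose dg (s : R) : R := df (s *: u + y).
have gc : {within `[0, h], continuous g}.
  by apply: derivable_within_continuous => t th; have [] := gD _ th.
have gD' t : t \in `]0, h[ -> is_derive t 1 g (dg t).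
  by move=> th; apply: gD; apply: subset_itv_oo_cc.
have [t] := MVT h0 gD' gc.
rewrite in_itv /= /g /dg scale0r add0r subr0 => /andP[t0 th] ->.
by exists t => //; rewrite !ltW.
Qed.

Lemma second_difference f u v x (h : R) (A : set V) : 0 < h ->
  (forall s t : R, 0 <= s <= h -> 0 <= t <= h -> A (s *: v + (t *: u + x))) ->
  (forall y, A y -> derivable f y u) ->
  (forall y, A y -> derivable ('D_u f) y v) ->
  exists s t : R, [/\ 0 <= s <= h, 0 <= t <= h &
    f (h *: u + (h *: v + x)) - f (h *: u + x) - f (h *: v + x) + f x =
    'D_v ('D_u f) (s *: v + (t *: u + x)) * h * h].
Proof.
move=> h0 Ah fu fuv.
have hh : 0 <= h <= h by rewrite (ltW h0) lexx.
have h00 : 0 <= (0 : R) <= h by rewrite lexx (ltW h0).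
(* The second difference is the increment of [g] along [u]. The mean value theorem turns it into an
   increment of ['D_u f] along [v], to which the theorem applies again. *)
pose g y := f (y + h *: v) - f y.
pose dg y := 'D_u f (y + h *: v) - 'D_u f y.
have gD (t : R) : 0 <= t <= h -> is_derive (t *: u + x) u g (dg (t *: u + x)).
  move=> th; apply: is_deriveB.
    apply: is_derive_shift_arg; apply: derivableP; apply: fu.
    by rewrite addrC; exact: Ah.
  by apply: derivableP; apply: fu; have := Ah 0 t h00 th; rewrite scale0r add0r.
have [t th gE] := MVT_line h0 gD.
have [s sh fE] : exists2 s : R, 0 <= s <= h &
    'D_u f (h *: v + (t *: u + x)) - 'D_u f (t *: u + x) =
    'D_v ('D_u f) (s *: v + (t *: u + x)) * h.
  apply: (@MVT_line ('D_u f) v (t *: u + x) h ('D_v ('D_u f)) h0) => s sh.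
  apply: derivableP; apply: fuv.
  exact: Ah.
exists s, t; split=> //.
rewrite -fE [X in 'D_u f X - _]addrC -/(dg _) -gE /g.
rewrite -(addrA (h *: u)) (addrC x) opprB (addrC (f x)) !addrA.
by rewrite -!addrA; congr (_ + _); rewrite addrCA.
Qed.

(* The second difference quotient is a value of either mixed derivative at a
   nearby point, by two applications of the mean value theorem. *)
Lemma schwarz A f u v x : open A -> A x -> Ck 2 A f ->
  'D_u ('D_v f) x = 'D_v ('D_u f) x.
Proof.
move=> oA Ax [df Df].
have [dv /(_ u) Dvu] := Df v; have [du /(_ v) Duv] := Df u.
apply/eqP; rewrite -subr_eq0 -normr_le0; apply/ler_addgt0Pl => e e0; rewrite addr0.
have e2 : 0 < e / 2 by rewrite divr_gt0.
have Evu : \forall y \near x, `|'D_u ('D_v f) x - 'D_u ('D_v f) y| <= e / 2.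
  by have /cvgrPdist_le/(_ _ e2) := Dvu x Ax.
have Euv : \forall y \near x, `|'D_v ('D_u f) x - 'D_v ('D_u f) y| <= e / 2.
  by have /cvgrPdist_le/(_ _ e2) := Duv x Ax.
have EA : \forall y \near x, A y by exact: (open_nbhs_nbhs (conj oA Ax)).
have /nbhs_ballP[r /= r0 Hr] : \forall y \near x, [/\ A y,
    `|'D_u ('D_v f) x - 'D_u ('D_v f) y| <= e / 2 &
    `|'D_v ('D_u f) x - 'D_v ('D_u f) y| <= e / 2].
  by apply: filterS3 EA Evu Euv.
(* Small enough for the whole parallelogram spanned by [h *: u] and [h *: v] at [x] to lie in the
   ball of radius [r]; the [+ 1] keeps the denominator positive when [u] and [v] vanish. *)
pose h := r / (2 * (`|u| + `|v| + 1)).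
have d0 : 0 < 2 * (`|u| + `|v| + 1).
  by rewrite mulr_gt0 // ltr_wpDl // addr_ge0.
have h0 : 0 < h by rewrite divr_gt0.
have inb a b (s t : R) : `|a| + `|b| <= `|u| + `|v| -> 0 <= s <= h -> 0 <= t <= h ->
    ball x r (s *: b + (t *: a + x)).
  move=> ab /andP[s0 sh] /andP[t0 th].
  rewrite -ball_normE /= addrA [X in x - X]addrC opprD addrA subrr add0r normrN.
  apply: le_lt_trans (ler_normD _ _) _; rewrite !normrZ !ger0_norm //.
  have le1 : s * `|b| + t * `|a| <= h * (`|a| + `|b|).
    by rewrite mulrDr addrC lerD // ler_wpM2r.
  apply: le_lt_trans le1 _.
  apply: le_lt_trans (ler_wpM2l (ltW h0) ab) _.
  rewrite /h mulrAC ltr_pdivrMr // ltr_pM2l //.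
  have := normr_ge0 u; have := normr_ge0 v; lra.
have EB y : ball x r y -> A y by move=> /Hr[].
have [s [t [sh th E1]]] := @second_difference f u v x h (ball x r) h0
  (fun s t => @inb u v s t (lexx _))
  (fun y By => diff_derivable (df y (EB y By)))
  (fun y By => diff_derivable (du y (EB y By))).
have vu : `|v| + `|u| <= `|u| + `|v| by rewrite addrC.
have [s' [t' [sh' th' E2]]] := @second_difference f v u x h (ball x r) h0
  (fun s t => @inb v u s t vu)
  (fun y By => diff_derivable (df y (EB y By)))
  (fun y By => diff_derivable (dv y (EB y By))).
have [_ _ B1] := Hr _ (inb u v s t (lexx _) sh th).
have [_ B2 _] := Hr _ (inb v u s' t' vu sh' th').
(* The second difference is symmetric in [u] and [v], so [E1] and [E2] evaluate the same number.
   Dividing by [h * h] equates the two mixed derivatives at two points near [x]. *)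
rewrite (addrCA (h *: v)) [X in X + f x = _]addrAC in E2.
have hn : h != 0 by rewrite gt_eqF.
have cancel (p q : R) : p * h * h = q * h * h -> p = q.
  by move=> /(mulIf hn)/(mulIf hn).
have Em := cancel _ _ (etrans (esym E1) E2).
rewrite Em in B1.
have triangle (p q m : R) : `|p - m| <= e / 2 -> `|q - m| <= e / 2 -> `|p - q| <= e.
  move=> pm qm; rewrite [e]splitr -(subrKA m) -(opprB q m).
  by apply: le_trans (ler_normB _ _) _; exact: lerD.
exact: triangle B2 B1.
Qed.

Lemma schwarz_mx p q A (f : V -> 'M[R]_(p, q)) u v x : open A -> A x ->
  Ck 2 A f -> 'D_u ('D_v f) x = 'D_v ('D_u f) x.
Proof.
move=> oA Ax cf; have [df Df] := cf; apply/matrixP => i j.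
have near_coord w : \forall y \near x, ('D_w f y) i j = 'D_w (fun z => f z i j) y.
  move: (open_nbhs_nbhs (conj oA Ax)); apply: filterS => y Ay.
  by rewrite derive_coord //; exact: df.
have [[dv _] [du _]] := (Df v, Df u).
apply: etrans (derive_coord u i j (dv x Ax)) _.
apply: etrans _ (esym (derive_coord v i j (du x Ax))).
apply: etrans (near_eq_derive _ (near_coord v)) _.
apply: etrans _ (esym (near_eq_derive _ (near_coord u))).
exact: (schwarz _ _ oA Ax ((Ck_mxP 2 f oA).1 cf i j)).
Qed.

End schwarz.

(** * Closure properties of smooth maps *)

Section smooth_lemmas.
Context {R : realType} {V : normedModType R}.
Variable (A : set V).
Hypothesis oA : open A.

Lemma smooth_differentiable {W : normedModType R} (f : V -> W) x :
  smooth_on A f -> A x -> differentiable f x.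
Proof. by move=> /(_ 1%N)[df _] /df. Qed.

Lemma smooth_derivable {W : normedModType R} (f : V -> W) x v :
  smooth_on A f -> A x -> derivable f x v.
Proof. by move=> sf Ax; apply: diff_derivable; exact: smooth_differentiable Ax. Qed.

Lemma smooth_derive {W : normedModType R} (f : V -> W) v :
  smooth_on A f -> smooth_on A ('D_v f).
Proof. by move=> sf k; have [_] := sf k.+1; exact. Qed.

Lemma smooth_ext {W : normedModType R} (f g : V -> W) :
  (forall x, A x -> f x = g x) -> smooth_on A f -> smooth_on A g.
Proof. by move=> fg sf k; apply: Ck_ext (sf k). Qed.

Lemma smooth_cst {W : normedModType R} (c : W) : smooth_on A (fun=> c).
Proof. by move=> k; exact: Ck_cst. Qed.

Lemma smoothD {W : normedModType R} (f g : V -> W) :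
  smooth_on A f -> smooth_on A g -> smooth_on A (fun x => f x + g x).
Proof. by move=> sf sg k; exact: CkD. Qed.

Lemma smooth_sum {W : normedModType R} I (r : seq I) (P : pred I)
    (F : I -> V -> W) : (forall i, smooth_on A (F i)) ->
  smooth_on A (fun x => \sum_(i <- r | P i) F i x).
Proof. by move=> sF k; apply: Ck_sum => // i; exact: sF. Qed.

Lemma smoothM (f g : V -> R) :
  smooth_on A f -> smooth_on A g -> smooth_on A (fun x => f x * g x).
Proof. by move=> sf sg k; exact: CkM. Qed.

Lemma smooth_prod I (r : seq I) (P : pred I) (F : I -> V -> R) :
  (forall i, smooth_on A (F i)) ->
  smooth_on A (fun x => \prod_(i <- r | P i) F i x).
Proof. by move=> sF k; apply: Ck_prod => // i; exact: sF. Qed.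

Lemma smoothV (f : V -> R) : (forall x, A x -> f x != 0) ->
  smooth_on A f -> smooth_on A (fun x => (f x)^-1).
Proof. by move=> f0 sf k; exact: CkV. Qed.

Lemma smooth_mxP p q (f : V -> 'M[R]_(p, q)) :
  smooth_on A f <-> forall i j, smooth_on A (fun y => f y i j).
Proof.
split=> [sf i j k|sf k]; first by move/(Ck_mxP k f oA): (sf k).
by apply/(Ck_mxP k f oA) => i j; exact: sf.
Qed.

Lemma smooth_mulmx p q r (f : V -> 'M[R]_(p, q)) (g : V -> 'M[R]_(q, r)) :
  smooth_on A f -> smooth_on A g -> smooth_on A (fun x => f x *m g x).
Proof.
move=> /smooth_mxP sf /smooth_mxP sg; apply/smooth_mxP => i j.
have sS := smooth_sum (index_enum 'I_q) xpredT (fun k => smoothM (sf i k) (sg k j)).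
by apply: smooth_ext sS => x _; rewrite mxE.
Qed.

Lemma smooth_tr p q (f : V -> 'M[R]_(p, q)) :
  smooth_on A f -> smooth_on A (fun x => (f x)^T).
Proof.
move=> /smooth_mxP sf; apply/smooth_mxP => i j.
by apply: smooth_ext (sf j i) => x _; rewrite mxE.
Qed.

Lemma smoothZ p q (c : V -> R) (f : V -> 'M[R]_(p, q)) :
  smooth_on A c -> smooth_on A f -> smooth_on A (fun x => c x *: f x).
Proof.
move=> sc /smooth_mxP sf; apply/smooth_mxP => i j.
by apply: smooth_ext (smoothM sc (sf i j)) => x _; rewrite mxE.
Qed.

Lemma smoothB p q (f g : V -> 'M[R]_(p, q)) :
  smooth_on A f -> smooth_on A g -> smooth_on A (fun x => f x - g x).
Proof.
move=> sf sg.
have sN := smoothZ (smooth_cst (-1 : R)) sg.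
by apply: smooth_ext (smoothD sf sN) => x _; rewrite scaleN1r.
Qed.

Lemma smooth_det p (f : V -> 'M[R]_p) :
  smooth_on A f -> smooth_on A (fun x => \det (f x)).
Proof.
move=> /smooth_mxP sf; apply: smooth_sum => s; apply: smoothM.
  exact: smooth_cst.
by apply: smooth_prod => i; exact: sf.
Qed.

(** By Cramer's rule the inverse is the adjugate, whose entries are signed minors, divided by a
    determinant that does not vanish on [A]. *)
Lemma smooth_invmx p (f : V -> 'M[R]_p) :
  (forall x, A x -> f x \in unitmx) ->
  smooth_on A f -> smooth_on A (fun x => invmx (f x)).
Proof.
move=> fU sf.
have sD : smooth_on A (fun x => (\det (f x))^-1).
  by apply: smoothV (smooth_det sf) => x /fU; rewrite unitmxE unitfE.
have sadj : smooth_on A (fun x => \adj (f x)).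
  apply/smooth_mxP => i j.
  have sM : smooth_on A (fun x => row' j (col' i (f x))).
    apply/smooth_mxP => k l; move/smooth_mxP: sf => /(_ (lift j k) (lift i l)).
    by apply: smooth_ext => x _; rewrite !mxE.
  apply: smooth_ext (smoothM (smooth_cst ((-1) ^+ (j + i) : R)) (smooth_det sM)) => x _.
  by rewrite mxE.
apply: smooth_ext (smoothZ sD sadj) => x Ax.
by rewrite /invmx fU.
Qed.

Lemma differentiable_mulmx p q r (f : V -> 'M[R]_(p, q)) (g : V -> 'M[R]_(q, r)) x :
  differentiable f x -> differentiable g x -> differentiable (fun y => f y *m g y) x.
Proof.
move=> df dg; apply/differentiable_mxP => i j.
have -> : (fun y => (f y *m g y) i j) =
    \sum_k ((fun y => f y i k) * (fun y => g y k j)).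
  by apply/funext => y; rewrite mxE fct_sumE.
by apply: differentiable_sum => k; apply: differentiableM; exact: (differentiable_mxP _ _).1.
Qed.

Lemma derive_mulmx p q r (f : V -> 'M[R]_(p, q)) (g : V -> 'M[R]_(q, r)) x v :
  differentiable f x -> differentiable g x ->
  'D_v (fun y => f y *m g y) x = 'D_v f x *m g x + f x *m 'D_v g x.
Proof.
move=> df dg; apply/matrixP => i j.
have df' := (differentiable_mxP f x).1 df.
have dg' := (differentiable_mxP g x).1 dg.
have dM k : derivable ((fun y => f y i k) * (fun y => g y k j)) x v.
  by apply: derivableM; apply: diff_derivable.
have E : (fun y => (f y *m g y) i j) =
    \sum_k ((fun y => f y i k) * (fun y => g y k j)).
  by apply/funext => y; rewrite mxE fct_sumE.
rewrite (derive_coord v i j (differentiable_mulmx df dg)).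
rewrite E derive_sum // !mxE -big_split /=; apply: eq_bigr => k _.
apply: etrans (deriveM (diff_derivable (df' i k)) (diff_derivable (dg' k j))) _.
rewrite addrC; congr (_ + _); first by rewrite (derive_coord v k j dg).
by rewrite (derive_coord v i k df); exact: mulrC.
Qed.

End smooth_lemmas.

(** * Chain rule and composition *)

Section chain_rule.
Context {R : realType} {V : normedModType R} {m : nat}.

Lemma derive_comp {W : normedModType R} (F : V -> 'rV[R]_m) (G : 'rV[R]_m -> W) x v :
  differentiable F x -> differentiable G (F x) ->
  'D_v (fun y => G (F y)) x = 'D_('D_v F x) G (F x).
Proof.
move=> dF dG; rewrite !deriveE //; last exact: differentiable_comp.
by rewrite diff_comp.
Qed.

Lemma derive_delta {W : normedModType R} (G : 'rV[R]_m -> W) y v :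
  differentiable G y ->
  'D_v G y = \sum_(i < m) v 0 i *: 'D_(delta_mx 0 i) G y.
Proof.
move=> dG; rewrite deriveE // {1}(row_sum_delta v) linear_sum.
by apply: eq_bigr => i _; rewrite linearZ deriveE.
Qed.

(** The chain rule writes a derivative of the composite as a sum of entries of ['D_v F] times
    partial derivatives of [G] taken along [F], to which the induction hypothesis applies. It must
    therefore be general in [G]. *)
Lemma Ck_comp k (A : set V) (B : set 'rV[R]_m) (F : V -> 'rV[R]_m)
    (G : 'rV[R]_m -> R) : open A -> (forall x, A x -> B (F x)) ->
  Ck k A F -> Ck k B G -> Ck k A (fun x => G (F x)).
Proof.
move=> oA AB; elim: k G => [|k IH] G cF cG.
  by move=> x Ax; apply: continuous_comp; [exact: cF|exact/cG/AB].
have [dF DF] := cF; have [dG DG] := cG.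
split=> [x Ax|v].
  by apply: differentiable_comp; [exact: dF|exact/dG/AB].
have cDF i : Ck k A (fun x => 'D_v F x 0 i) by move/(Ck_mxP k _ oA): (DF v).
have cS := Ck_sum (index_enum _) xpredT oA
  (fun i => CkM oA (cDF i) (IH _ (CkW cF) (DG (delta_mx 0 i)))).
apply: Ck_ext cS => // x Ax.
rewrite derive_comp; [|exact: dF|exact/dG/AB].
by rewrite [RHS]derive_delta //; exact/dG/AB.
Qed.

Lemma smooth_comp p q (A : set V) (B : set 'rV[R]_m) (F : V -> 'rV[R]_m)
    (G : 'rV[R]_m -> 'M[R]_(p, q)) : open A -> open B ->
  (forall x, A x -> B (F x)) ->
  smooth_on A F -> smooth_on B G -> smooth_on A (fun x => G (F x)).
Proof.
move=> oA oB AB sF /(smooth_mxP oB) sG; apply/(smooth_mxP oA) => i j k.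
exact: Ck_comp AB (sF k) (sG i j k).
Qed.

End chain_rule.

(** * Inner products and Christoffel symbols *)

Section inner_algebra.
Context {R : realType} {n : nat}.
Implicit Types (A B : 'M[R]_n) (u v w : 'rV[R]_n).

Lemma innerDl A u v w : inner A (u + v) w = inner A u w + inner A v w.
Proof. by rewrite /inner !mulmxDl mxE. Qed.

Lemma innerDr A u v w : inner A u (v + w) = inner A u v + inner A u w.
Proof. by rewrite /inner linearD mulmxDr mxE. Qed.

Lemma innerZl A k u v : inner A (k *: u) v = k * inner A u v.
Proof. by rewrite /inner -!scalemxAl mxE. Qed.

Lemma innerZr A k u v : inner A u (k *: v) = k * inner A u v.
Proof. by rewrite /inner linearZ -scalemxAr mxE. Qed.

Lemma innerNl A u v : inner A (- u) v = - inner A u v.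
Proof. by rewrite -scaleN1r innerZl mulN1r. Qed.

Lemma innerNr A u v : inner A u (- v) = - inner A u v.
Proof. by rewrite -scaleN1r innerZr mulN1r. Qed.

Lemma innerBl A u v w : inner A (u - v) w = inner A u w - inner A v w.
Proof. by rewrite innerDl innerNl. Qed.

Lemma innerBr A u v w : inner A u (v - w) = inner A u v - inner A u w.
Proof. by rewrite innerDr innerNr. Qed.

Lemma inner0l A u : inner A 0 u = 0.
Proof. by rewrite /inner !mul0mx mxE. Qed.

Lemma inner_tr A u v : inner A^T u v = inner A v u.
Proof.
rewrite /inner; have -> : u *m A^T *m v^T = (v *m A *m u^T)^T.
  by rewrite !trmx_mul trmxK mulmxA.
by rewrite mxE.
Qed.

Lemma innerE A u v : inner A u v = \sum_i \sum_j u 0 i * v 0 j * A i j.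
Proof.
rewrite /inner -mulmxA mxE; apply: eq_bigr => i _.
rewrite mxE mulr_sumr; apply: eq_bigr => j _.
by rewrite mxE mulrAC mulrA mulrAC.
Qed.

Lemma inner_delta A i j : inner A (delta_mx 0 i) (delta_mx 0 j) = A i j.
Proof. by rewrite /inner -rowE trmx_delta -colE !mxE. Qed.

Lemma inner_eq0 A w : A \in unitmx -> (forall v, inner A w v = 0) -> w = 0.
Proof.
move=> Au w0.
have wA : w *m A = 0.
  apply/rowP => j; rewrite [RHS]mxE -(w0 (delta_mx 0 j)) /inner trmx_delta.
  by rewrite -colE !mxE.
by rewrite -(mulmxK Au w) wA mul0mx.
Qed.

Lemma posdef_unitmx A : (forall u, u != 0 -> 0 < inner A u u) -> A \in unitmx.
Proof.
move=> Ap; rewrite unitmxE unitfE; apply/det0P => -[u u0 uA].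
by have := Ap u u0; rewrite /inner uA mul0mx mxE ltxx.
Qed.

(* Contracting W with Y gives (n - 2) A = - t g with t the g-trace of A; a
   second contraction gives (2n - 2) t = 0. *)
Lemma wedge_invariant_eq0 A g : (3 <= n)%N -> g^T = g -> g \in unitmx ->
  A^T = A ->
  (forall X Y W V, inner A (wedge g X Y W) V = inner A W (wedge g X Y V)) ->
  A = 0.
Proof.
move=> n3 gT gU AT H.
have gs i j : g i j = g j i by rewrite -[in LHS]gT mxE.
have As i j : A i j = A j i by rewrite -[in LHS]AT mxE.
pose gi := invmx g.
have ggi a b : \sum_k g a k * gi k b = (a == b)%:R.
  by have := mulmxV gU => /matrixP/(_ a b); rewrite !mxE.
have gig a b : \sum_k gi a k * g k b = (a == b)%:R.
  by have := mulVmx gU => /matrixP/(_ a b); rewrite !mxE.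
have E a b k l : g b k * A a l - g a k * A b l = g b l * A k a - g a l * A k b.
  have := H (delta_mx 0 a) (delta_mx 0 b) (delta_mx 0 k) (delta_mx 0 l).
  by rewrite /wedge innerBl innerBr !innerZl !innerZr !inner_delta.
have dsum (F : 'I_n -> R) a : \sum_b (a == b)%:R * F b = F a.
  rewrite (bigD1 a) //= eqxx mul1r big1 ?addr0 // => b ba.
  by rewrite eq_sym (negbTE ba) mul0r.
pose t := \sum_k \sum_b gi k b * A k b.
have trn : \sum_k \sum_b gi k b * g b k = n%:R.
  under eq_bigr do rewrite gig eqxx.
  by rewrite sumr_const card_ord.
have Eal a l : (n%:R - 2) * A a l = - t * g a l.
  (* The four sums contract the four terms of [E] with the inverse metric in [k] and [b]; they equal
     n A, A, A and t g respectively. *)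
  have S1 : \sum_k \sum_b gi k b * (g b k * A a l) = n%:R * A a l.
    rewrite -trn mulr_suml; apply: eq_bigr => k _; rewrite mulr_suml.
    by apply: eq_bigr => b _; rewrite mulrA.
  have S2 : \sum_k \sum_b gi k b * (g a k * A b l) = A a l.
    rewrite exchange_big /= -[RHS](dsum (fun b => A b l)); apply: eq_bigr => b _.
    by rewrite -ggi mulr_suml; apply: eq_bigr => k _; rewrite mulrCA mulrA.
  have S3 : \sum_k \sum_b gi k b * (g b l * A k a) = A a l.
    rewrite As -(dsum (fun k => A k a)); apply: eq_bigr => k _.
    rewrite eq_sym -gig mulr_suml; apply: eq_bigr => b _; exact: mulrA.
  have S4 : \sum_k \sum_b gi k b * (g a l * A k b) = t * g a l.
    rewrite mulr_suml; apply: eq_bigr => k _; rewrite mulr_suml.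
    by apply: eq_bigr => b _; rewrite mulrCA mulrC.
  have : \sum_k \sum_b gi k b * (g b k * A a l) - \sum_k \sum_b gi k b * (g a k * A b l)
       = \sum_k \sum_b gi k b * (g b l * A k a) - \sum_k \sum_b gi k b * (g a l * A k b).
    rewrite -!sumrB; apply: eq_bigr => k _; rewrite -!sumrB; apply: eq_bigr => b _.
    by rewrite -!mulrBr E.
  rewrite S1 S2 S3 S4 => Eq.
  by rewrite mulrBl mulNr; apply/eqP; rewrite -subr_eq0; apply/eqP; move: Eq; clear; lra.
have n3R : 3 <= n%:R :> R by rewrite (ler_nat R 3).
have t0 : t = 0.
  have : (n%:R - 2) * t = - t * n%:R.
    rewrite -[in RHS]trn [in LHS]/t [LHS]mulr_sumr [RHS]mulr_sumr; apply: eq_bigr => k _.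
    rewrite [LHS]mulr_sumr [RHS]mulr_sumr; apply: eq_bigr => b _.
    by rewrite mulrCA Eal (gs k) mulrCA.
  by move=> Et; have : (2 * n%:R - 2) * t = 0 by [move: Et; clear; lra];
     move/eqP; rewrite mulf_eq0 => /orP[/eqP h|/eqP //]; lra.
apply/matrixP => a l; rewrite mxE.
have /eqP := Eal a l; rewrite t0 oppr0 mul0r mulf_eq0 => /orP[/eqP h|/eqP //].
lra.
Qed.

End inner_algebra.

(** * Koszul formula, metric compatibility and torsion-freeness *)

Section koszul.
Context {R : realType} {n : nat}.
Variables (G : 'rV[R]_n -> 'M[R]_n) (y : 'rV[R]_n).
Hypothesis dG : differentiable G y.

(** Twice the Christoffel symbols of the first kind, contracted with [a] and [b]. *)
Let kappa (a b : 'rV[R]_n) l : R := \sum_i \sum_j a 0 i * b 0 j *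
  (partial i (fun z => G z j l) y + partial j (fun z => G z i l) y
   - partial l (fun z => G z i j) y).

Lemma derive_entry v i j :
  ('D_v G y) i j = \sum_k v 0 k * partial k (fun z => G z i j) y.
Proof.
rewrite (derive_delta v dG) summxE; apply: eq_bigr => k _.
by rewrite mxE /partial (derive_coord _ i j dG).
Qed.

Lemma christoffel_form_row a b :
  christoffel_form G y a b = 2^-1 *: (\row_l kappa a b l *m (invmx (G y))^T).
Proof.
apply/rowP => k; rewrite !mxE [RHS]mulr_sumr.
transitivity (\sum_i \sum_j \sum_l 2^-1 * (a 0 i * b 0 j *
  (partial i (fun z => G z j l) y + partial j (fun z => G z i l) y
   - partial l (fun z => G z i j) y) * invmx (G y) k l)).
  apply: eq_bigr => i _; apply: eq_bigr => j _.
  rewrite /christoffel mulrCA mulr_sumr mulr_sumr; apply: eq_bigr => l _.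
  by congr (_ * _); rewrite mulrCA mulrC.
under eq_bigr do rewrite exchange_big /=.
rewrite exchange_big; apply: eq_bigr => l _ /=.
rewrite !mxE mulr_suml mulr_sumr; apply: eq_bigr => i _.
by rewrite mulr_suml mulr_sumr.
Qed.

Lemma kappaE a b (w : 'rV[R]_n) : \sum_l kappa a b l * w 0 l =
  inner ('D_a G y) b w + inner ('D_b G y) a w - inner ('D_w G y) a b.
Proof.
pose X1 l : R := \sum_i \sum_j a 0 i * b 0 j * partial i (fun z => G z j l) y * w 0 l.
pose X2 l : R := \sum_i \sum_j a 0 i * b 0 j * partial j (fun z => G z i l) y * w 0 l.
pose X3 l : R := \sum_i \sum_j a 0 i * b 0 j * partial l (fun z => G z i j) y * w 0 l.
have S1 : inner ('D_a G y) b w = \sum_l X1 l.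
  rewrite innerE exchange_big; apply: eq_bigr => l _ /=; rewrite [RHS]exchange_big.
  apply: eq_bigr => j _ /=; rewrite derive_entry mulr_sumr.
  by apply: eq_bigr => i _; ring.
have S2 : inner ('D_b G y) a w = \sum_l X2 l.
  rewrite innerE exchange_big; apply: eq_bigr => l _ /=.
  apply: eq_bigr => j _ /=; rewrite derive_entry mulr_sumr.
  by apply: eq_bigr => i _; ring.
have S3 : inner ('D_w G y) a b = \sum_l X3 l.
  rewrite innerE [RHS]exchange_big; apply: eq_bigr => i _ /=; rewrite [RHS]exchange_big.
  apply: eq_bigr => j _ /=; rewrite derive_entry mulr_sumr.
  by apply: eq_bigr => l _; ring.
transitivity (\sum_l (X1 l + X2 l - X3 l)); last by rewrite S1 S2 S3 sumrB big_split.
apply: eq_bigr => l _; rewrite /X1 /X2 /X3 -big_split -sumrB mulr_suml.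
apply: eq_bigr => i _; rewrite -big_split -sumrB mulr_suml.
by apply: eq_bigr => j _ /=; ring.
Qed.

(** Pairing with [G y] cancels the inverse metric in the Christoffel symbols. No bracket terms
    appear because constant coordinate fields commute. *)
Lemma koszul a b w : (G y)^T = G y -> G y \in unitmx ->
  inner (G y) (christoffel_form G y a b) w =
  2^-1 * (inner ('D_a G y) b w + inner ('D_b G y) a w - inner ('D_w G y) a b).
Proof.
move=> GT GU; rewrite christoffel_form_row trmx_inv GT innerZl; congr (_ * _).
rewrite -kappaE /inner mulmxKV // mxE.
by apply: eq_bigr => l _; rewrite !mxE.
Qed.

Hypotheses (GT : (G y)^T = G y) (GU : G y \in unitmx).
(** Symmetry of [G] at the single point [y] says nothing about its derivatives there;
    [derive_tr_sym] obtains this from symmetry near [y]. *)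
Hypothesis DGT : forall a, ('D_a G y)^T = 'D_a G y.

Let dg a b c := inner ('D_a G y) b c.

Let dgC a b c : dg a b c = dg a c b.
Proof. by rewrite /dg -inner_tr DGT. Qed.

Let koszul_dg a b w : inner (G y) (christoffel_form G y a b) w =
  2^-1 * (dg a b w + dg b a w - dg w a b).
Proof. exact: koszul. Qed.

Let half_sum (p q r : R) : 2^-1 * (p + q - r) + 2^-1 * (p + r - q) = p.
Proof. by field. Qed.

Let half_swap (p q r : R) : 2^-1 * (p + q - r) - 2^-1 * (q + p - r) = 0.
Proof. by rewrite [p + q]addrC subrr. Qed.

Lemma christoffel_form_compat a b w :
  inner (G y) (christoffel_form G y a b) w
  + inner (G y) b (christoffel_form G y a w) = inner ('D_a G y) b w.
Proof.
have -> : inner (G y) b (christoffel_form G y a w) =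
          inner (G y) (christoffel_form G y a w) b by rewrite -inner_tr GT.
rewrite !koszul_dg (dgC a w b) (dgC w a b) (dgC b a w); exact: half_sum.
Qed.

Lemma christoffel_formC a b : christoffel_form G y a b = christoffel_form G y b a.
Proof.
apply/eqP; rewrite -subr_eq0; apply/eqP; apply: (inner_eq0 GU) => w.
rewrite innerBl !koszul_dg (dgC w a b); exact: half_swap.
Qed.

End koszul.

Lemma christoffel_form0l (R : realType) (n : nat) (G : 'rV[R]_n -> 'M[R]_n) y b :
  christoffel_form G y 0 b = 0.
Proof.
apply/rowP => k; rewrite !mxE; apply: big1 => i _; apply: big1 => j _.
by rewrite mxE !mul0r.
Qed.

Section derive_inner.
Context {R : realType} {V : normedModType R} {n : nat}.

Lemma derive_inner (M : V -> 'M[R]_n) (a b : V -> 'rV[R]_n) u y :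
  differentiable M y -> differentiable a y -> differentiable b y ->
  'D_u (fun z => inner (M z) (a z) (b z)) y =
  inner ('D_u M y) (a y) (b y) + inner (M y) ('D_u a y) (b y)
  + inner (M y) (a y) ('D_u b y).
Proof.
move=> dM da db.
have bT i j : (fun z => (b z)^T i j) = (fun z => b z j i).
  by apply/funext => z; rewrite mxE.
have dbT : differentiable (fun z => (b z)^T) y.
  by apply/differentiable_mxP => i j; rewrite bT; exact: (differentiable_mxP b y).1.
have DbT : 'D_u (fun z => (b z)^T) y = ('D_u b y)^T.
  apply/matrixP => i j; apply: etrans (derive_coord u i j dbT) _.
  by rewrite [RHS]mxE (derive_coord u j i db) bT.
have daM : differentiable (fun z => a z *m M z) y.
  exact: differentiable_mulmx.
have daMb : differentiable (fun z => a z *m M z *m (b z)^T) y.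
  exact: differentiable_mulmx.
rewrite /inner -(derive_coord u 0 0 daMb) (derive_mulmx u daM dbT).
rewrite (derive_mulmx u da dM) DbT mulmxDl [LHS]mxE [X in X + _ = _]mxE.
by congr (_ + _); exact: addrC.
Qed.

Lemma derive_tr_sym n' (M : V -> 'M[R]_n') y u : (\near y, (M y)^T = M y) ->
  differentiable M y -> ('D_u M y)^T = 'D_u M y.
Proof.
move=> MT dM; apply/matrixP => i j.
rewrite [LHS]mxE (derive_coord u j i dM) (derive_coord u i j dM).
apply: near_eq_derive; apply: filterS MT => z E.
by rewrite -[in LHS]E mxE.
Qed.

Lemma derive_inner_cst (M : V -> 'M[R]_n) a b u y : differentiable M y ->
  inner ('D_u M y) a b = 'D_u (fun z => inner (M z) a b) y.
Proof.
move=> dM; rewrite derive_inner //.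
by rewrite !derive_cst inner0l -[inner _ _ 0]inner_tr inner0l !addr0.
Qed.

End derive_inner.

Section smooth_christoffel.
Context {R : realType} {V : normedModType R} {n : nat}.
Variables (A : set V) (B : set 'rV[R]_n) (F : V -> 'rV[R]_n)
  (G : 'rV[R]_n -> 'M[R]_n).
Hypotheses (oA : open A) (oB : open B) (AB : forall x, A x -> B (F x)).
Hypotheses (sF : smooth_on A F) (sG : smooth_on B G)
  (GU : forall x, B x -> G x \in unitmx).

Lemma smooth_inner p (M : V -> 'M[R]_p) a b : smooth_on A M ->
  smooth_on A a -> smooth_on A b -> smooth_on A (fun x => inner (M x) (a x) (b x)).
Proof.
move=> sM sa sb.
exact: ((smooth_mxP oA _).1 (smooth_mulmx oA (smooth_mulmx oA sa sM) (smooth_tr oA sb))).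
Qed.

(** Stated along a map [F] in order to serve both the ambient connection pulled back by the
    immersion and, with [F] the identity, the intrinsic connection. *)
Lemma smooth_christoffel_form (a b : V -> 'rV[R]_n) :
  smooth_on A a -> smooth_on A b ->
  smooth_on A (fun x => christoffel_form G (F x) (a x) (b x)).
Proof.
move=> sa sb.
have sp i j l : smooth_on A (fun x => partial i (fun z => G z j l) (F x)).
  move=> k; apply: Ck_comp AB (sF k) _ => //.
  by apply: smooth_derive; exact: (smooth_mxP oB _).1.
have sI : smooth_on A (fun x => invmx (G (F x))).
  apply: smooth_invmx => //; first by move=> x /AB/GU.
  exact: smooth_comp AB sF sG.
have sI' := (smooth_mxP oA _).1 sI.
have sa' := (smooth_mxP oA _).1 sa; have sb' := (smooth_mxP oA _).1 sb.
apply/(smooth_mxP oA) => i' k.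
suff : smooth_on A (fun x => \sum_i \sum_j a x 0 i * b x 0 j *
    (2^-1 * \sum_l invmx (G (F x)) k l *
      (partial i (fun z => G z j l) (F x) + partial j (fun z => G z i l) (F x)
       + (-1) * partial l (fun z => G z i j) (F x)))).
  apply: smooth_ext => // x _; rewrite mxE; apply: eq_bigr => i _.
  apply: eq_bigr => j _; congr (_ * (_ * _)); apply: eq_bigr => l _.
  by rewrite mulN1r.
have sc (c : R) : smooth_on A (fun=> c) by exact: smooth_cst.
apply: smooth_sum => // i; apply: smooth_sum => // j.
apply: (smoothM oA); first exact: (smoothM oA).
apply: (smoothM oA) => //; apply: smooth_sum => // l.
apply: (smoothM oA) => //; apply: (smoothD oA); first exact: (smoothD oA).
exact: (smoothM oA).
Qed.

End smooth_christoffel.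

(** * Lagrangian immersions in coordinates *)

Section lagrangian_immersion.
Context {R : realType} {n m : nat}.
Variables (U : set 'rV[R]_n) (V : set 'rV[R]_m).
Variables (F : 'rV[R]_n -> 'rV[R]_m) (G J : 'rV[R]_m -> 'M[R]_m).
Hypotheses (oU : open U) (oV : open V) (UV : forall y, U y -> V (F y)).
Hypotheses (sF : smooth_on U F) (sG : smooth_on V G) (sJ : smooth_on V J).
Hypothesis GT : forall z, V z -> (G z)^T = G z.
Hypothesis Gpos : forall z, V z -> forall u, u != 0 -> 0 < inner (G z) u u.
Hypothesis JJ : forall z, V z -> J z *m J z = - 1%:M.
Hypothesis Jorth : forall z, V z -> forall u v,
  inner (G z) (u *m J z) (v *m J z) = inner (G z) u v.
Hypothesis Jpar : forall z, V z -> forall u v,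
  levi_civita G (cst u) (fun y => v *m J y) z =
  levi_civita G (cst u) (cst v) z *m J z.
Hypothesis imm : forall y, U y -> forall v, 'D_v F y = 0 -> v = 0.
Hypothesis lag : forall y, U y -> forall w,
  (forall v, inner (G (F y)) w ('D_v F y) = 0) <->
  (exists v, w = 'D_v F y *m J (F y)).

(* The Jacobian of F acting on row vectors on the right: row i is dF(e_i). *)
Let P y : 'M[R]_(n, m) := \matrix_(i, j) 'D_(delta_mx 0 i) F y 0 j.
Local Notation g := (induced_metric F G).

Let GU z : V z -> G z \in unitmx.
Proof. by move=> /Gpos; exact: posdef_unitmx. Qed.

Let dF y : U y -> differentiable F y.
Proof. exact: smooth_differentiable. Qed.

Let row_P i y : row i (P y) = 'D_(delta_mx 0 i) F y.
Proof. by apply/rowP => j; rewrite !mxE. Qed.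

Let DF y v : U y -> 'D_v F y = v *m P y.
Proof.
move=> Uy; rewrite (derive_delta v (dF Uy)) mulmx_sum_row.
by apply: eq_bigr => i _; rewrite row_P.
Qed.

Let P_inj y (v : 'rV[R]_n) : U y -> v *m P y = 0 -> v = 0.
Proof. by move=> Uy; rewrite -DF //; exact: imm. Qed.

Let gE y : g y = P y *m G (F y) *m (P y)^T.
Proof.
apply/matrixP => i j; rewrite mxE -!row_P -[RHS]inner_delta /inner !rowE.
by rewrite trmx_mul !mulmxA.
Qed.

Let inner_g y (a b : 'rV[R]_n) : inner (g y) a b = inner (G (F y)) (a *m P y) (b *m P y).
Proof. by rewrite /inner gE trmx_mul !mulmxA. Qed.

Let gT y : U y -> (g y)^T = g y.
Proof. by move=> Uy; rewrite gE !trmx_mul trmxK GT ?mulmxA //; exact: UV. Qed.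

Let g_unit y : U y -> g y \in unitmx.
Proof.
move=> Uy; apply: posdef_unitmx => u u0; rewrite inner_g.
by apply: Gpos (UV Uy) _ _; apply: contra_neq u0; exact: P_inj.
Qed.

Let innerC y u v : U y -> inner (G (F y)) u v = inner (G (F y)) v u.
Proof. by move=> Uy; rewrite -inner_tr GT //; exact: UV. Qed.

Let innerJl y u v : U y -> inner (G (F y)) (u *m J (F y)) v = - inner (G (F y)) u (v *m J (F y)).
Proof.
move=> /UV Vy; rewrite -(Jorth Vy (u *m _)) -mulmxA JJ // mulmxN mulmx1.
exact: innerNl.
Qed.

Let normal y w := forall v : 'rV[R]_n, inner (G (F y)) w (v *m P y) = 0.

Let normalJ y (v : 'rV[R]_n) : U y -> normal y (v *m P y *m J (F y)).
Proof.
move=> Uy a; rewrite -(DF a Uy).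
by move: a; apply: (lag Uy _).2; exists v; rewrite DF.
Qed.

Let normal_exists y w : U y -> normal y w -> exists v : 'rV[R]_n, w = v *m P y *m J (F y).
Proof.
move=> Uy wN; have [v ->] : exists v, w = 'D_v F y *m J (F y).
  by apply/(lag Uy) => v; rewrite DF.
by exists v; rewrite DF.
Qed.

(** Orthogonal projection onto the row space of [P y] in matrix form; facts about projections become
    cancellations of [g] against its inverse. *)
Let tangent_partE y w :
  tangent_part F G y w = w *m G (F y) *m (P y)^T *m invmx (g y) *m P y.
Proof.
rewrite /tangent_part [RHS]mulmx_sum_row exchange_big; apply: eq_bigr => j _ /=.
rewrite row_P -scaler_suml mxE; congr (_ *: _); apply: eq_bigr => i _.
rewrite mulrC -row_P; congr (_ * _).
by rewrite /inner rowE trmx_mul trmx_delta mulmxA -colE !mxE.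
Qed.

Let tangent_partP y w (t : 'rV[R]_n) : U y ->
  (forall v : 'rV[R]_n, inner (G (F y)) w (v *m P y) = inner (g y) t v) ->
  tangent_part F G y w = t *m P y.
Proof.
move=> Uy H; rewrite tangent_partE; congr (_ *m _).
have -> : w *m G (F y) *m (P y)^T = t *m g y.
  apply/rowP => j; have := H (delta_mx 0 j).
  by rewrite /inner trmx_mul mulmxA trmx_delta -!colE !mxE.
by rewrite mulmxK // g_unit.
Qed.

Let inner_tangent_part y w (v : 'rV[R]_n) : U y ->
  inner (G (F y)) (tangent_part F G y w) (v *m P y) = inner (G (F y)) w (v *m P y).
Proof.
move=> Uy; rewrite tangent_partE -inner_g /inner mulmxKV ?g_unit //.
by rewrite trmx_mul !mulmxA.
Qed.

Let normal_part_normal y w : U y -> normal y (normal_part F G y w).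
Proof. by move=> Uy v; rewrite /normal_part innerBl inner_tangent_part // subrr. Qed.

Let inner_normal_part y w xi : U y -> normal y xi ->
  inner (G (F y)) (normal_part F G y w) xi = inner (G (F y)) w xi.
Proof.
move=> Uy xiN; rewrite /normal_part innerBl tangent_partE.
by rewrite [X in _ - X]innerC // xiN subr0.
Qed.

Let normal_partD y a b :
  normal_part F G y (a + b) = normal_part F G y a + normal_part F G y b.
Proof. by rewrite /normal_part !tangent_partE !mulmxDl opprD addrACA. Qed.

Let normal_part_tangent y (v : 'rV[R]_n) : U y -> normal_part F G y (v *m P y) = 0.
Proof.
by move=> Uy; rewrite /normal_part (@tangent_partP _ _ v) ?subrr.
Qed.

Let normal_part_id y w : U y -> normal y w -> normal_part F G y w = w.
Proof.
move=> Uy wN; rewrite /normal_part (@tangent_partP _ _ 0) ?mul0mx ?subr0 // => v.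
by rewrite wN inner0l.
Qed.

Let sGF : smooth_on U (fun y => G (F y)).
Proof. exact: smooth_comp UV sF sG. Qed.

Let sJF : smooth_on U (fun y => J (F y)).
Proof. exact: smooth_comp UV sF sJ. Qed.

Let sP : smooth_on U P.
Proof.
apply/(smooth_mxP oU) => i j.
have := (smooth_mxP oU _).1 (smooth_derive (delta_mx 0 i) sF) 0 j.
by apply: smooth_ext => // y _; rewrite mxE.
Qed.

Let sg : smooth_on U g.
Proof.
have := smooth_mulmx oU (smooth_mulmx oU sP sGF) (smooth_tr oU sP).
by apply: smooth_ext => // y _; rewrite gE.
Qed.

Let scst k (a : 'rV[R]_k) : smooth_on U (cst a).
Proof. exact: smooth_cst. Qed.

Let scov u (W : 'rV[R]_n -> 'rV[R]_m) : smooth_on U W ->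
  smooth_on U (cov_along F G (cst u) W).
Proof.
move=> sW; apply: (smoothD oU); first exact: smooth_derive.
by apply: smooth_christoffel_form UV sF sG GU _ _ _ _ => //; exact: smooth_derive.
Qed.

Let snormal (W : 'rV[R]_n -> 'rV[R]_m) : smooth_on U W ->
  smooth_on U (fun y => normal_part F G y (W y)).
Proof.
move=> sW; apply: (smoothB oU) => //.
have sI : smooth_on U (fun y => invmx (g y)) by apply: smooth_invmx => // y /g_unit.
have sT := smooth_mulmx oU (smooth_mulmx oU (smooth_mulmx oU
  (smooth_mulmx oU sW sGF) (smooth_tr oU sP)) sI) sP.
by apply: smooth_ext sT => // y _; rewrite tangent_partE.
Qed.

Let sNconn u (W : 'rV[R]_n -> 'rV[R]_m) : smooth_on U W ->
  smooth_on U (normal_connection F G (cst u) W).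
Proof. by move=> sW; apply: snormal; exact: scov. Qed.

Let sh v w : smooth_on U (fun y => second_form F G y v w).
Proof. by apply: snormal; apply: scov; exact: smooth_derive. Qed.

Let sid : smooth_on U (fun y : 'rV[R]_n => y).
Proof.
case=> [|k] /=; first by move=> y _; exact: cvg_id.
split=> [y _|v]; first exact: (@ex_diff _ _ _ _ _ _ _ (is_diff_id y)).
apply: Ck_ext (Ck_cst k U v) => // y _.
by rewrite [RHS]derive_id.
Qed.

Let slc u (Y : 'rV[R]_n -> 'rV[R]_n) : smooth_on U Y ->
  smooth_on U (levi_civita g (cst u) Y).
Proof.
move=> sY; apply: (smoothD oU); first exact: smooth_derive.
exact: (smooth_christoffel_form oU oU (fun y Uy => Uy) sid sg g_unit).
Qed.

Let cov_cst u (W : 'rV[R]_n -> 'rV[R]_m) y : U y ->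
  cov_along F G (cst u) W y =
  'D_u W y + christoffel_form G (F y) (u *m P y) (W y).
Proof. by move=> Uy; rewrite /cov_along DF. Qed.

Let dG y : U y -> differentiable G (F y).
Proof. by move=> /UV; exact: smooth_differentiable. Qed.

Let DGT y a : U y -> ('D_a G (F y))^T = 'D_a G (F y).
Proof.
move=> Uy; apply: derive_tr_sym (dG Uy).
by move: (open_nbhs_nbhs (conj oV (UV Uy))); apply: filterS.
Qed.

(** By the chain rule the metric along [F] varies as [G] does in the direction dF(u), and
    [christoffel_form_compat] splits that variation between the two fields. *)
Let metric_compat u (W1 W2 : 'rV[R]_n -> 'rV[R]_m) y : U y ->
  smooth_on U W1 -> smooth_on U W2 ->
  'D_u (fun z => inner (G (F z)) (W1 z) (W2 z)) y =
  inner (G (F y)) (cov_along F G (cst u) W1 y) (W2 y)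
  + inner (G (F y)) (W1 y) (cov_along F G (cst u) W2 y).
Proof.
move=> Uy s1 s2; have Vy := UV Uy.
rewrite (derive_inner u (smooth_differentiable sGF Uy)
  (smooth_differentiable s1 Uy) (smooth_differentiable s2 Uy)).
rewrite (derive_comp u (dF Uy) (dG Uy)) !cov_cst // innerDl innerDr (DF u Uy).
rewrite -(christoffel_form_compat (dG Uy) (GT Vy) (GU Vy) (fun a => DGT a Uy)).
move: (inner _ _ _) (inner _ _ _) (inner _ _ _) (inner _ _ _) => p q r s.
by rewrite [q + s]addrC [p + r]addrC -!addrA [q + (r + p)]addrCA.
Qed.

(** Second derivatives of [F] commute by Schwarz, and the Christoffel form is symmetric. *)
Let torsion_free u v y : U y ->
  cov_along F G (cst u) ('D_v F) y = cov_along F G (cst v) ('D_u F) y.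
Proof.
move=> Uy; have Vy := UV Uy.
have S := schwarz_mx u v oU Uy (sF 2).
have S2 : christoffel_form G (F y) (u *m P y) ('D_v F y) =
          christoffel_form G (F y) (v *m P y) ('D_u F y).
  rewrite (DF u Uy) (DF v Uy).
  exact: christoffel_formC (dG Uy) (GT Vy) (GU Vy) (fun a => DGT a Uy) _ _.
apply: etrans (cov_cst u _ Uy) _; apply: etrans _ (esym (cov_cst v _ Uy)).
exact: (f_equal2 +%R S S2).
Qed.

(** Parallelism of [J] is given for constant vectors only. The product rule isolates the derivative
    of [J], and the hypothesis is applied to the vector [W y] frozen at the point, in the direction
    dF(u). *)
Let cov_J u (W : 'rV[R]_n -> 'rV[R]_m) y : U y -> smooth_on U W ->
  cov_along F G (cst u) (fun z => W z *m J (F z)) y =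
  cov_along F G (cst u) W y *m J (F y).
Proof.
move=> Uy sW; have Vy := UV Uy.
have dJ : differentiable J (F y) by exact: smooth_differentiable Vy.
have dW : differentiable W y by exact: smooth_differentiable Uy.
rewrite !cov_cst // derive_mulmx //; last exact: smooth_differentiable Uy.
rewrite (derive_comp u (dF Uy) dJ) DF // mulmxDl -addrA; congr (_ + _).
have := Jpar Vy (u *m P y) (W y).
rewrite /levi_civita derive_cst add0r (derive_mulmx _ (differentiable_cst _ _) dJ).
by rewrite derive_cst mul0mx add0r.
Qed.

Let cov_ext u (W W' : 'rV[R]_n -> 'rV[R]_m) y : U y ->
  (forall z, U z -> W z = W' z) ->
  cov_along F G (cst u) W y = cov_along F G (cst u) W' y.
Proof.
move=> Uy E; have D : 'D_u W y = 'D_u W' y.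
  apply: near_eq_derive.
  by move: (open_nbhs_nbhs (conj oU Uy)); apply: filterS.
rewrite /cov_along (E y Uy); exact: (f_equal (fun d => d + _) D).
Qed.

Let koszul_sum (c : 'rV[R]_n -> 'rV[R]_n -> 'rV[R]_n -> R) u v w :
  (forall a b d, c a b d = c b a d) ->
  2^-1 * ((c u v w + c u w v) + (c v u w + c v w u) - (c w u v + c w v u)) = c u v w.
Proof.
move=> cC; rewrite (cC v u) (cC w u) (cC w v).
move: (c u v w) (c u w v) (c v w u) => p q r.
by field.
Qed.

(* Metric compatibility and torsion-freeness along F reduce both sides to the
   same Koszul expression. *)
Let gauss u v y : U y ->
  tangent_part F G y (cov_along F G (cst u) ('D_v F) y) =
  christoffel_form g y u v *m P y.
Proof.
move=> Uy; apply: (tangent_partP Uy) => w.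
pose c a b d := inner (G (F y)) (cov_along F G (cst a) ('D_b F) y) (d *m P y).
have cC a b d : c a b d = c b a d.
  exact: (f_equal (fun z => inner (G (F y)) z (d *m P y)) (torsion_free a b Uy)).
have dg := smooth_differentiable sg Uy.
have Dg a b d : inner ('D_a g y) b d = c a b d + c a d b.
  apply: etrans (derive_inner_cst b d a dg) _.
  have M := metric_compat a Uy (smooth_derive b sF) (smooth_derive d sF).
  apply: etrans (_ : _ = 'D_a (fun z => inner (G (F z)) ('D_b F z) ('D_d F z)) y) _.
    apply: near_eq_derive; move: (open_nbhs_nbhs (conj oU Uy)); apply: filterS => z Uz.
    by rewrite (DF b Uz) (DF d Uz); exact: inner_g.
  apply: etrans M _; rewrite (DF b Uy) (DF d Uy) /c.
  exact: (f_equal (fun t => _ + t) (innerC _ _ Uy)).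
have K := koszul dg u v w (gT Uy) (g_unit Uy).
apply: etrans (esym (koszul_sum u v w cC)) (esym (etrans K _)).
exact: (f_equal2 (fun s d => 2^-1 * (s - d))
  (f_equal2 +%R (Dg u v w) (Dg v u w)) (Dg w u v)).
Qed.

(** Gauss formula for fields with variable coordinates: [gauss] handles the coefficients frozen at
    [y], and the product rule adds their derivative. *)
Let cov_YP u (Y : 'rV[R]_n -> 'rV[R]_n) y : U y -> smooth_on U Y ->
  cov_along F G (cst u) (fun z => Y z *m P z) y =
  levi_civita g (cst u) Y y *m P y + second_form F G y u (Y y).
Proof.
move=> Uy sY.
have dY := smooth_differentiable sY Uy; have dP := smooth_differentiable sP Uy.
have DP : Y y *m 'D_u P y = 'D_u ('D_(Y y) F) y.
  apply: etrans (_ : _ = 'D_u (fun z => Y y *m P z) y) _.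
    rewrite (derive_mulmx u (differentiable_cst (Y y) y) dP).
    by rewrite derive_cst mul0mx add0r.
  apply: near_eq_derive; move: (open_nbhs_nbhs (conj oU Uy)); apply: filterS => z Uz.
  exact/esym/DF.
have E : cov_along F G (cst u) (fun z => Y z *m P z) y =
    'D_u Y y *m P y + cov_along F G (cst u) ('D_(Y y) F) y.
  apply: etrans (cov_cst _ _ Uy) _.
  apply: etrans _ (f_equal (fun t => 'D_u Y y *m P y + t) (esym (cov_cst _ _ Uy))).
  apply: etrans _ (esym (addrA _ _ _)).
  apply: f_equal2; last by rewrite (DF (Y y) Uy).
  apply: etrans (derive_mulmx u dY dP) _.
  exact: (f_equal (fun t => _ + t) DP).
apply: etrans E _; rewrite /second_form /normal_part (gauss u (Y y) Uy).
rewrite /levi_civita mulmxDl -addrA; congr (_ + _).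
by rewrite addrC subrK.
Qed.

(** Apply [J] to the Gauss formula: the tangent term becomes normal, while the second fundamental
    form, itself [J] of a tangent vector, becomes tangent and is killed by the projection. *)
Let nconn_YPJ u (Y : 'rV[R]_n -> 'rV[R]_n) y : U y -> smooth_on U Y ->
  normal_connection F G (cst u) (fun z => Y z *m P z *m J (F z)) y =
  levi_civita g (cst u) Y y *m P y *m J (F y).
Proof.
move=> Uy sY; rewrite /normal_connection (cov_J u Uy (smooth_mulmx oU sY sP)).
rewrite (cov_YP u Uy sY) mulmxDl normal_partD (normal_part_id Uy (normalJ _ Uy)).
have [s E] : exists s : 'rV[R]_n, second_form F G y u (Y y) = s *m P y *m J (F y).
  by apply: normal_exists => //; exact: normal_part_normal.
rewrite E.
rewrite -[_ *m J (F y) *m J (F y)]mulmxA JJ ?mulmxN ?mulmx1; last exact: UV.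
by rewrite -mulNmx (normal_part_tangent _ Uy) addr0.
Qed.

Let nconn_compat u xi eta y : U y -> smooth_on U xi -> smooth_on U eta ->
  (forall z, U z -> normal z (xi z)) -> (forall z, U z -> normal z (eta z)) ->
  'D_u (fun z => inner (G (F z)) (xi z) (eta z)) y =
  inner (G (F y)) (normal_connection F G (cst u) xi y) (eta y)
  + inner (G (F y)) (xi y) (normal_connection F G (cst u) eta y).
Proof.
move=> Uy s1 s2 n1 n2; rewrite (metric_compat u Uy s1 s2).
rewrite (inner_normal_part _ Uy (n2 _ Uy)) [X in _ = _ + X](innerC _ _ Uy).
by rewrite (inner_normal_part _ Uy (n1 _ Uy)) [X in _ = _ + X](innerC _ _ Uy).
Qed.

Let nconn_ext u xi eta y : U y -> (forall z, U z -> xi z = eta z) ->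
  normal_connection F G (cst u) xi y = normal_connection F G (cst u) eta y.
Proof. by move=> Uy E; rewrite /normal_connection (cov_ext u Uy E). Qed.

(* The cubic form C(z,w,v) = g(h(z,w), J dF(v)); symmetric in w and v. *)
Let C y z w v := inner (G (F y)) (second_form F G y z w) (v *m P y *m J (F y)).

Let C_cov y z w v : U y ->
  C y z w v = inner (G (F y)) (cov_along F G (cst z) ('D_w F) y) (v *m P y *m J (F y)).
Proof. by move=> Uy; rewrite /C (inner_normal_part _ Uy (normalJ _ Uy)). Qed.

(** Differentiate g(dF(w), J dF(v)) = 0 along [z]: [J] commutes with the derivative, and moving it
    across the metric changes the sign. *)
Let C_sym23 y z w v : U y -> C y z w v = C y z v w.
Proof.
move=> Uy; apply: etrans (C_cov z w v Uy) (etrans _ (esym (C_cov z v w Uy))).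
have sv := smooth_mulmx oU (scst v) sP.
have svJ := smooth_mulmx oU sv sJF.
have sw := smooth_mulmx oU (scst w) sP.
have cw : cov_along F G (cst z) (fun z => w *m P z) y = cov_along F G (cst z) ('D_w F) y.
  by apply: cov_ext => // z' Uz; exact/esym/DF.
have cv : cov_along F G (cst z) (fun z => v *m P z) y = cov_along F G (cst z) ('D_v F) y.
  by apply: cov_ext => // z' Uz; exact/esym/DF.
have M := metric_compat z Uy sw svJ.
have M0 : 'D_z (fun z0 => inner (G (F z0)) (w *m P z0) (v *m P z0 *m J (F z0))) y = 0.
  apply: etrans (_ : _ = 'D_z (fun=> 0) y) _; last exact: derive_cst.
  apply: near_eq_derive; move: (open_nbhs_nbhs (conj oU Uy)); apply: filterS => z' Uz.
  apply: etrans (innerC _ _ Uz) _; exact: normalJ.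
have cvJ := etrans (cov_J z Uy sv) (f_equal (fun t => t *m J (F y)) cv).
have E := f_equal2 (fun s t => inner (G (F y)) s (v *m P y *m J (F y))
  + inner (G (F y)) (w *m P y) t) cw cvJ.
have {E M M0} := etrans (esym E) (etrans (esym M) M0).
move: (cov_along _ _ _ _ _) (cov_along _ _ _ _ _) => a b /eqP.
rewrite addr_eq0 => /eqP ->; rewrite -(innerJl _ _ Uy); exact: innerC.
Qed.

(** The second fundamental form is some J dF(s), so its squared norm is the value of [C] at [s]. *)
Let second_form_eq0 y z w : U y -> (forall v, C y z w v = 0) -> second_form F G y z w = 0.
Proof.
move=> Uy C0.
have [s E] : exists s : 'rV[R]_n, second_form F G y z w = s *m P y *m J (F y).
  by apply: normal_exists => //; exact: normal_part_normal.
have [//|h0] := eqVneq (second_form F G y z w) 0.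
have := Gpos (UV Uy) h0.
by rewrite {2}E -/(C y z w s) C0 ltxx.
Qed.

Let ricci_alg (p q r s p' s' : R) :
  (p + q) + (r + s) = (p' + r) + (q + s') -> p - p' = - (s - s').
Proof.
move=> E; apply/eqP; rewrite -subr_eq0 opprK; apply/eqP.
have -> : p - p' + (s - s') = (p + q) + (r + s) - ((p' + r) + (q + s')) by ring.
by rewrite E subrr.
Qed.

(* Both sides differentiate the function g(h(z,w), J dF(v)), whose second
   derivatives in X and Y commute; R^perp(X,Y) J dF(v) = J dF(R(X,Y)v) because
   the normal connection is conjugate to the Levi-Civita one under J dF. *)
Let ricci y X Y z w v : U y ->
  inner (G (F y)) (curvature (normal_connection F G) (cst X) (cst Y)
     (fun y' => second_form F G y' z w) y) (v *m P y *m J (F y)) =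
  - C y z w (riemann g y X Y v).
Proof.
move=> Uy.
pose xi y' := second_form F G y' z w.
pose eta y' := v *m P y' *m J (F y').
pose N u f := normal_connection F G (cst u) f.
have sxi : smooth_on U xi by exact: sh.
have seta : smooth_on U eta by exact: smooth_mulmx (smooth_mulmx oU (scst v) sP) sJF.
have nxi z' : U z' -> normal z' (xi z') by exact: normal_part_normal.
have neta z' : U z' -> normal z' (eta z') by exact: normalJ.
have nN u f z' : U z' -> normal z' (N u f z') by exact: normal_part_normal.
have Neta u z' : U z' -> N u eta z' = levi_civita g (cst u) (cst v) z' *m P z' *m J (F z').
  by move=> Uz; exact: (nconn_YPJ u Uz (scst v)).
have NNeta a b : N a (N b eta) y =
    levi_civita g (cst a) (levi_civita g (cst b) (cst v)) y *m P y *m J (F y).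
  apply: etrans (nconn_ext a Uy (fun z' Uz => Neta b z' Uz)) _.
  exact: (nconn_YPJ a Uy (slc b (scst v))).
have bracket0 : lie_bracket (cst X) (cst Y) y = 0.
  by rewrite /lie_bracket !derive_cst subrr.
pose al z' := inner (G (F z')) (xi z') (eta z').
have Dal u z' : U z' -> 'D_u al z' = inner (G (F z')) (N u xi z') (eta z')
    + inner (G (F z')) (xi z') (N u eta z').
  by move=> Uz; exact: nconn_compat.
(* The two mixed products, each with one derivative on [xi] and one on [eta], are exchanged by
   swapping [a] and [b]; they drop out when the two orders are compared. *)
have DDal a b : 'D_a ('D_b al) y =
    (inner (G (F y)) (N a (N b xi) y) (eta y) + inner (G (F y)) (N b xi y) (N a eta y))
    + (inner (G (F y)) (N a xi y) (N b eta y) + inner (G (F y)) (xi y) (N a (N b eta) y)).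
  have E : \near y, 'D_b al y = inner (G (F y)) (N b xi y) (eta y)
      + inner (G (F y)) (xi y) (N b eta y).
    by move: (open_nbhs_nbhs (conj oU Uy)); apply: filterS => z' /Dal.
  apply: etrans (near_eq_derive _ E) _.
  have s1 := smooth_inner oU sGF (sNconn b sxi) seta.
  have s2 := smooth_inner oU sGF sxi (sNconn b seta).
  have D := deriveD (smooth_derivable (v := a) s1 Uy) (smooth_derivable (v := a) s2 Uy).
  have D1 := nconn_compat a Uy (sNconn b sxi) seta (fun z' => @nN b xi z') neta.
  have D2 := nconn_compat a Uy sxi (sNconn b seta) nxi (fun z' => @nN b eta z').
  exact: (etrans D (f_equal2 +%R D1 D2)).
have S := schwarz X Y oU Uy (smooth_inner oU sGF sxi seta 2).
have E := etrans (esym (DDal X Y)) (etrans S (DDal Y X)).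
have N0 : normal_connection F G (lie_bracket (cst X) (cst Y)) xi y = 0.
  rewrite /normal_connection /cov_along bracket0 !derive0 christoffel_form0l addr0.
  by have := normal_part_tangent 0 Uy; rewrite mul0mx.
have R0 : levi_civita g (lie_bracket (cst X) (cst Y)) (cst v) y = 0.
  by rewrite /levi_civita bracket0 derive0 christoffel_form0l addr0.
have rE : riemann g y X Y v *m P y *m J (F y) =
    N X (N Y eta) y - N Y (N X eta) y.
  by rewrite /riemann /curvature R0 subr0 !mulmxBl !NNeta.
rewrite /C rE /curvature N0 subr0 innerBl innerBr.
exact: ricci_alg E.
Qed.

Let C_sum y z w v : C y z w v = \sum_j v 0 j * C y z w (delta_mx 0 j).
Proof.
pose c := second_form F G y z w *m G (F y) *m (P y *m J (F y))^T.
have cE u : C y z w u = (c *m u^T) 0 0.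
  by rewrite /C /inner /c -(mulmxA u) (trmx_mul u) !mulmxA.
rewrite cE mxE; apply: eq_bigr => j _; rewrite cE mulrC.
by rewrite trmx_delta -colE !mxE.
Qed.

Let Rbar_h_C y X Y z w v : U y ->
  inner (G (F y)) (Rbar_h F G y X Y z w) (v *m P y *m J (F y)) =
  - C y z w (riemann g y X Y v) - C y (riemann g y X Y z) w v
  - C y z (riemann g y X Y w) v.
Proof.
move=> Uy; apply: etrans (innerBl _ _ _ _) _.
apply: (f_equal (fun s => s - _)); apply: etrans (innerBl _ _ _ _) _.
exact: (f_equal (fun s => s - _) (ricci X Y z w v Uy)).
Qed.

(** Swapping [w] and [v] exchanges the outer two terms and preserves the middle one. *)
Let derivation_sym y (A : 'rV[R]_n -> 'rV[R]_n) z w v : U y ->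
  - C y z w (A v) - C y (A z) w v - C y z (A w) v =
  - C y z v (A w) - C y (A z) v w - C y z (A v) w.
Proof.
move=> Uy; rewrite (C_sym23 z w (A v) Uy) (C_sym23 (A z) w v Uy) (C_sym23 z (A w) v Uy).
by rewrite addrAC [RHS]addrAC [X in X - _ = _]addrC.
Qed.

Let Rbar_h_sym y X Y z w v : U y ->
  inner (G (F y)) (Rbar_h F G y X Y z w) (v *m P y *m J (F y)) =
  inner (G (F y)) (Rbar_h F G y X Y z v) (w *m P y *m J (F y)).
Proof.
move=> Uy; apply: etrans (Rbar_h_C X Y z w v Uy) _.
apply: etrans _ (esym (Rbar_h_C X Y z v w Uy)).
exact: (derivation_sym (riemann g y X Y) z w v Uy).
Qed.

(** Here [phi] is the value at the one point [y]; the equation is assumed at [y] only, while the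
    geometry is used on all of [U]. *)
Lemma lagrangian_pseudo_parallel y phi : (3 <= n)%N -> U y ->
  (forall X Y Z W, Rbar_h F G y X Y Z W + phi *: Q_gh F G y X Y Z W = 0) ->
  forall X Y Z W, Rbar_h F G y X Y Z W = 0.
Proof.
move=> n3 Uy H.
have [phi0 X Y Z W|phi0] := eqVneq phi 0.
  by have := H X Y Z W; rewrite phi0 scale0r addr0.
have RQ X Y Z W : Rbar_h F G y X Y Z W = - (phi *: Q_gh F G y X Y Z W).
  by apply/eqP; rewrite -addr_eq0 H.
have IR X Y z w v :
    inner (G (F y)) (Rbar_h F G y X Y z w) (v *m P y *m J (F y)) =
    - (phi * (C y (wedge (g y) X Y z) w v + C y z (wedge (g y) X Y w) v)).
  apply: etrans (f_equal (fun s => inner _ s _) (RQ X Y z w)) _.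
  apply: etrans (innerNl _ _ _) (f_equal -%R _).
  apply: etrans (innerZl _ _ _ _) (f_equal ( *%R phi) _).
  exact: innerDl.
have Qsym X Y z w v :
    C y (wedge (g y) X Y z) w v + C y z (wedge (g y) X Y w) v =
    C y (wedge (g y) X Y z) v w + C y z (wedge (g y) X Y v) w.
  by have /oppr_inj/(mulfI phi0) :=
    etrans (esym (IR X Y z w v)) (etrans (Rbar_h_sym X Y z w v Uy) (IR X Y z v w)).
have Bsym X Y z w v : C y z (wedge (g y) X Y w) v = C y z w (wedge (g y) X Y v).
  have := Qsym X Y z w v.
  rewrite (C_sym23 _ w v Uy) => /addrI ->; exact: C_sym23.
have C0 z w v : C y z w v = 0.
  pose A := \matrix_(i, j) C y z (delta_mx 0 i) (delta_mx 0 j) : 'M[R]_n.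
  (* [C_sum] gives linearity in the last slot; [C_sym23] brings the middle slot there. *)
  have AE u u' : inner A u u' = C y z u u'.
    rewrite innerE C_sym23 // C_sum; apply: eq_bigr => i _.
    rewrite C_sym23 // C_sum mulr_sumr; apply: eq_bigr => j _.
    by rewrite mxE mulrA.
  have A0 : A = 0.
    apply: (wedge_invariant_eq0 n3 (gT Uy) (g_unit Uy)).
      by apply/matrixP => i j; rewrite !mxE; exact: C_sym23.
    by move=> X Y u u'; rewrite !AE.
  by rewrite -AE A0 /inner mulmx0 mul0mx mxE.
have h0 z w : second_form F G y z w = 0 by apply: second_form_eq0.
by move=> X Y Z W; rewrite RQ /Q_gh !h0 addr0 scaler0 oppr0.
Qed.

End lagrangian_immersion.

(** * From coordinates to manifolds *)

Lemma open_coord_image (R : realType) (n : nat) (M : smooth_manifold R n)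
    (i : chart M) (A : set M) : open A -> open (Defs.coord i @` (dom i `&` A)).
Proof.
move=> oA; rewrite openE => _ [p [ip Ap] <-].
have ix : (Defs.coord i @` dom i) (Defs.coord i p) by exists p.
(* Near the point, the image contains the preimage of [A] under the continuous inverse [param i],
   cut down to the open chart image. *)
have nA : nbhs (param i (Defs.coord i p)) A.
  by rewrite coordK //; exact: open_nbhs_nbhs.
have nP : \forall x \near Defs.coord i p, A (param i x) by exact: param_continuous ix _ nA.
apply: filterS2 (open_nbhs_nbhs (conj (@image_open _ _ M i) ix)) nP => _ [q iq <-].
rewrite coordK // => Aq.
by exists q.
Qed.

Theorem theorem1 (R : realType) (n : nat) (c : R) (hn : (3 <= n)%N)
    (N : kaehler_manifold R n)
    (hN : constant_holomorphic_curvature N (4 * c))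
    (M : smooth_manifold R n) (f : M -> N)
    (hf : immersion f) (hL : lagrangian f)
    (hP : pseudo_parallel f) :
  semi_parallel f.
Proof.
move=> p i a ip ap; have [fc fs fi] := hf; have [phi H] := hP.
(* The local representative is meaningful only where [f] lands in the target chart, so the source
   chart is cut down accordingly. *)
pose U := Defs.coord i @` (dom i `&` f @^-1` dom a).
have oU : open U.
  by apply: open_coord_image; apply: open_comp (@dom_open _ _ N a) => q _; exact: fc.
have UV y : U y -> (Defs.coord a @` dom a) (local_rep f i a y).
  by move=> [q [iq aq] <-]; exists (f q) => //; rewrite /local_rep /= coordK.
apply: (lagrangian_pseudo_parallel oU (@image_open _ _ N a) UV (fs i a)
  (metric_smooth a) (cplx_smooth a) _ _ _ _ _ _ _ hn _ (H p i a ip ap)).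
- exact: (@Defs.metric_sym _ _ N a).
- exact: (@metric_posdef _ _ N a).
- exact: (@cplx_sqr _ _ N a).
- exact: (@cplx_orthogonal _ _ N a).
- exact: (@cplx_parallel _ _ N a).
- by move=> _ [q [iq aq] <-] v; exact: fi.
- by move=> _ [q [iq aq] <-]; exact: hL.
- by exists p.
Qed.
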